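(* For $\alpha>0$ let $(u^\alpha,v^\alpha)=(u^\alpha_n,v^\alpha_n)$ denote a solution of $$\min_{u\in\mathcal X,\ v\in\mathcal Y}\frac1\alpha\mathcal H(v\mid f_n)+\mathcal J(u)\quad\text{subject to}\quad A^l_nu\le v\le A^u_nu.$$ Suppose that for all $n$ $$C\delta_n\le\liminf_{\alpha\to\infty}\mathcal H(v^\alpha\mid f_n)$$ for some constant $C>1$ which does not depend on $n$. Then the discrepancy principle $$\alpha_n=\sup\{\alpha>0:\mathcal H(v^\alpha_n\mid f_n)\le\tau\delta_n\}$$ is well-posed for all $\tau\in(1,C)$, i.e. there exist $\alpha_n>0$ and a solution $(u^{\alpha_n},v^{\alpha_n})$ of the minimisation problem $$\min_{u\in\mathcal X,\ v\in\mathcal Y}\frac1{\alpha_n}\mathcal H(v\mid f_n)+\mathcal J(u)\quad\text{subject to}\quad A^l_nu\le v\le A^u_nu$$ such that the discrepancy principle $\alpha_n=\sup\{\alpha>0:\mathcal H(v^\alpha_n\mid f_n)\le\tau\delta_n\}$ is satisfied.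
   Context: $\mathcal X=\mathcal U^*$ and $\mathcal Y=\mathcal V^*$ are duals of Banach lattices with the dual norm and dual partial order ($y\ge0$ iff $\langle y,v\rangle\ge0$ for all $v\in\mathcal V$, $v\ge0$). Standing assumptions: $\mathcal J:\mathcal X\to[0,+\infty]$ is proper, convex, weakly-* lower semicontinuous with weakly-* sequentially compact non-empty sublevel sets; $\mathcal H:\mathcal Y\times\mathcal Y\to[0,+\infty]$ is proper, convex in its first argument, jointly weakly-* lower semicontinuous, and $\mathcal H(v\mid f)=0$ iff $v=f$; $A,A^l_n,A^u_n:\mathcal X\to\mathcal Y$ are bounded linear, weak-* to weak-* continuous, with $A^l_nu\le Au\le A^u_nu$ for all $u\ge0$. There is $u^\dagger_{\mathcal J}\ge0$ with $Au^\dagger_{\mathcal J}=\bar f$, $\mathcal J(u^\dagger_{\mathcal J})\le\mathcal J(u)$ whenever $Au=\bar f$, and $\mathcal J(u^\dagger_{\mathcal J})<\infty$. The data $f_n\in\mathcal Y$ satisfy $\mathcal H(\bar f\mid f_n)\le\delta_n$ with noise level $\delta_n>0$. *)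

(* Defs.v *)
From HB Require Import structures.
From mathcomp Require Import all_boot all_order all_algebra.
From mathcomp Require Import all_classical all_reals.
From mathcomp Require Import topology normedtype sequences ereal.

Set Implicit Arguments.
Unset Strict Implicit.
Unset Printing Implicit Defensive.

Import Order.TTheory GRing.Theory Num.Theory.
Import numFieldNormedType.Exports.

Local Open Scope classical_set_scope.
Local Open Scope ring_scope.

(* The order is a field of the structure rather than an [Order.Lattice]
   instance: a join of [Order.Lattice] with [CompleteNormedModule] clashes with
   the coercion graph of the ordered rings.  Binary infima need no field of
   their own, since [- bl_join (- x) (- y)] is the infimum of [x] and [y]. *)
HB.mixin Record isBanachLattice (R : realType) V of CompleteNormedModule R V := {
  bl_le : V -> V -> Prop ;
  bl_join : V -> V -> V ;
  bl_le_refl : forall x, bl_le x x ;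
  bl_le_anti : forall x y, bl_le x y -> bl_le y x -> x = y ;
  bl_le_trans : forall y x z, bl_le x y -> bl_le y z -> bl_le x z ;
  bl_leU : forall x y z,
    bl_le (bl_join x y) z <-> bl_le x z /\ bl_le y z ;
  bl_leD : forall x y z, bl_le x y -> bl_le (x + z) (y + z) ;
  bl_leZ : forall (a : R) x y, 0 <= a -> bl_le x y -> bl_le (a *: x) (a *: y) ;
  bl_le_norm : forall x y,
    bl_le (bl_join x (- x)) (bl_join y (- y)) -> `|x| <= `|y|
}.

#[short(type="banachLatticeType")]
HB.structure Definition BanachLattice (R : realType) :=
  {V of isBanachLattice R V & CompleteNormedModule R V}.

Section Dual.
Context {R : realType} (V : normedModType R).

Definition dual_pred : {pred V -> R^o} :=
  [pred phi : V -> R^o | `[< linear phi /\ continuous phi >]].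

Lemma dual_pred_submod : submod_closed dual_pred.
Proof.
split; first by apply/asboolP; split=> [a x y|x];
  [rewrite /GRing.zero /= scaler0 addr0 | exact: cst_continuous].
move=> a f g /asboolP[fl fc] /asboolP[gl gc]; apply/asboolP; split.
  move=> b x y; rewrite -[LHS]/(a *: f _ + g _) -[RHS]/(b *: (a *: f x + g x) + (a *: f y + g y)).
  by rewrite fl gl !scalerDr !scalerA (mulrC a b) addrACA.
move=> x; apply: (@continuousD _ _ _ (a \*: f : V -> R^o) g x _ (gc x)).
by apply: continuousZr => //; exact: fc.
Qed.

HB.instance Definition _ := GRing.isSubmodClosed.Build R (V -> R^o) dual_pred
  dual_pred_submod.

Record dual := Dual { dual_fun :> V -> R^o ; _ : dual_fun \in dual_pred }.

HB.instance Definition _ := [isSub for dual_fun].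
HB.instance Definition _ := [Choice of dual by <:].
HB.instance Definition _ := [SubChoice_isSubLmodule of dual by <:].

(* The topology attached to [dual V] is the weak-* one; the norm topology of
   the dual enters only through [dual_norm]. *)
HB.instance Definition _ := Topological.copy dual
  (initial_topology (dual_fun : dual -> {ptws V -> R^o})).

Definition dual_norm (y : dual) : R := sup [set `|y v| | v in [set v | `|v| <= 1]].

End Dual.

Section DualLattice.
Context {R : realType}.

Definition dual_le (V : banachLatticeType R) (y z : dual V) :=
  forall v : V, bl_le 0 v -> y v <= z v.

Definition dual_bounded (U V : normedModType R) (A : dual U -> dual V) :=
  exists M : R, forall u, dual_norm (A u) <= M * dual_norm u.

End DualLattice.

Definition eproper (R : realType) (T : Type) (F : T -> \bar R) :=
  exists x, (F x < +oo)%E.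

Definition econvex (R : realType) (E : lmodType R) (F : E -> \bar R) :=
  forall (t : R) (x y : E), 0 <= t -> t <= 1 ->
    (F (t *: x + (1 - t) *: y)%R <= t%:E * F x + (1 - t)%:E * F y)%E.

Definition sequentially_compact (T : topologicalType) (K : set T) :=
  forall x : nat -> T, (forall n, K (x n)) ->
    exists2 phi : nat -> nat, {homo phi : m n / (m < n)%N} &
      exists2 l, K l & (x \o phi) n @[n --> \oo] --> l.

Section Minimisation.
Context {R : realType} {U V : banachLatticeType R}.
Variables (J : dual U -> \bar R) (H : dual V -> dual V -> \bar R).
Variables (Al Au : dual U -> dual V) (f : dual V).

Definition feasible (u : dual U) (v : dual V) :=
  dual_le (Al u) v /\ dual_le v (Au u).

Definition objective (a : R) (u : dual U) (v : dual V) : \bar R :=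
  ((a^-1)%:E * H v f + J u)%E.

Definition is_solution (a : R) (u : dual U) (v : dual V) :=
  feasible u v /\
  forall u' v', feasible u' v' -> (objective a u v <= objective a u' v')%E.

End Minimisation.

Definition discrepancy_sup (R : realType) (V : normedModType R)
    (H : dual V -> dual V -> \bar R) (f : dual V) (v : R -> dual V)
    (eta : R) : \bar R :=
  ereal_sup [set a%:E | a in [set a : R | 0 < a /\ (H (v a) f <= eta%:E)%E]].

(* Main.v *)
Require Import Defs.
From HB Require Import structures.
From mathcomp Require Import all_boot all_order all_algebra.
From mathcomp Require Import all_classical all_reals.
From mathcomp Require Import topology normedtype sequences ereal.

Import Order.TTheory GRing.Theory Num.Theory.
Import numFieldNormedType.Exports.

Local Open Scope classical_set_scope.
Local Open Scope ring_scope.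

(** Write [h a] for the discrepancy [H (v a) f] of the given solution at the
    parameter [a], and [S] for the set of all [a > 0] with
    [h a <= tau * delta].  The theorem says that [sup S] is a positive real
    number and that a solution exists there.

    - [S] is nonempty.  The exact solution competes: [(udag, fbar)] is feasible
      because the operator bounds enclose [A udag = fbar].  Minimality and
      [J >= 0] then give [h a <= delta + a * J udag]
      ([solution_discrepancy_le]).  Since [tau > 1], this is at most
      [tau * delta] for small [a].
    - [S] is bounded above.  The lower limit of [h] at infinity is at least
      [C * delta], which exceeds [tau * delta]; so [h] stays above
      [tau * delta] on a half-line ([limf_einf_gt_near]).

    Hence [sup S] is real and positive.  The solution selected there is the
    given one, [(u (sup S), v (sup S))]: with this choice the modified family
    in the definition of the supremum is the original family, so its
    supremum is [sup S] by construction. *)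

(** Comparison with a feasible competitor of finite energy [j]: as [J] is
    nonnegative, the energy of the minimiser may be dropped, which leaves
    [a^-1 * H v f <= a^-1 * d + j]. *)
Lemma solution_discrepancy_le (R : realType) (U V : banachLatticeType R)
    (J : dual U -> \bar R) (H : dual V -> dual V -> \bar R)
    (Al Au : dual U -> dual V) (f : dual V) (a d j : R)
    (u u' : dual U) (v v' : dual V) :
  (forall x, 0 <= J x)%E -> 0 < a ->
  is_solution J H Al Au f a u v ->
  feasible Al Au u' v' -> (H v' f <= d%:E)%E -> (J u' <= j%:E)%E ->
  (H v f <= (d + a * j)%:E)%E.
Proof.
move=> J_ge0 a_gt0 [_ minimal] feas Hd Jj.
have ai_gt0 : 0 < a^-1 by rewrite invr_gt0.
have dropJ : (a^-1%:E * H v f <= (a^-1 * d + j)%:E)%E.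
  apply: (@le_trans _ _ (objective J H f a u v)); first by rewrite leeDl.
  apply: (le_trans (minimal _ _ feas)); rewrite EFinD EFinM.
  by apply: leeD => //; rewrite lee_pmul2l.
rewrite -(@lee_pmul2l _ a^-1%:E) // -EFinM mulrDr mulKf //.
by rewrite gt_eqF.
Qed.

Lemma limf_einf_gt_near (R : realType) (T : choiceType) (X : filteredType T)
    (h : X -> \bar R) (F : set_system X) (c : \bar R) :
  Filter F -> (c < limf_einf h F)%E -> \forall x \near F, (c < h x)%E.
Proof.
rewrite limf_einfE => FF /ereal_sup_gt[_ [B FB <-] cB].
apply: filterS FB => x Bx; apply: (lt_le_trans cB).
by apply: ereal_inf_lbound; exists x.
Qed.

Theorem theorem4p6 (R : realType) (U V : banachLatticeType R)
  (J : dual U -> \bar R) (H : dual V -> dual V -> \bar R)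
  (A : {linear dual U -> dual V}) (Al Au : nat -> {linear dual U -> dual V})
  (udag : dual U) (fbar : dual V) (f : nat -> dual V) (delta : nat -> R)
  (u : nat -> R -> dual U) (v : nat -> R -> dual V) (C : R)
  (J_ge0 : forall x, (0 <= J x)%E)
  (J_proper : eproper J)
  (J_convex : econvex J)
  (J_lsc : lower_semicontinuous J)
  (J_compact : forall c : R, [set x | (J x <= c%:E)%E] !=set0 ->
     sequentially_compact [set x | (J x <= c%:E)%E])
  (H_ge0 : forall y z, (0 <= H y z)%E)
  (H_proper : eproper (fun p : dual V * dual V => H p.1 p.2))
  (H_convex : forall z, econvex (fun y => H y z))
  (H_lsc : lower_semicontinuous (fun p : dual V * dual V => H p.1 p.2))
  (H_eq0 : forall y z, H y z = 0%E <-> y = z)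
  (A_bounded : dual_bounded A) (A_continuous : continuous A)
  (Al_bounded : forall n, dual_bounded (Al n))
  (Al_continuous : forall n, continuous (Al n))
  (Au_bounded : forall n, dual_bounded (Au n))
  (Au_continuous : forall n, continuous (Au n))
  (A_order : forall n x, dual_le 0 x ->
     dual_le (Al n x) (A x) /\ dual_le (A x) (Au n x))
  (udag_ge0 : dual_le 0 udag)
  (udag_exact : A udag = fbar)
  (udag_min : forall x, A x = fbar -> (J udag <= J x)%E)
  (udag_fin : (J udag < +oo)%E)
  (delta_gt0 : forall n, 0 < delta n)
  (noise : forall n, (H fbar (f n) <= (delta n)%:E)%E)
  (uv_solution : forall n (a : R), 0 < a ->
     is_solution J H (Al n) (Au n) (f n) a (u n a) (v n a))
  (C_gt1 : 1 < C)
  (C_liminf : forall n,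
     ((C * delta n)%:E <= limf_einf (fun a : R => H (v n a) (f n)) +oo%R)%E) :
  forall tau : R, 1 < tau -> tau < C -> forall n,
  exists an : R, 0 < an /\
  exists (un : dual U) (vn : dual V),
    is_solution J H (Al n) (Au n) (f n) an un vn /\
    an%:E = discrepancy_sup H (f n)
      (fun a => if a == an then vn else v n a) (tau * delta n).
Proof.
move=> tau tau_gt1 tau_ltC n.
pose S := [set a : R | 0 < a /\ (H (v n a) (f n) <= (tau * delta n)%:E)%E].
have feas : feasible (Al n) (Au n) udag fbar.
  by rewrite -udag_exact; exact: A_order.
have [b Sb] : S !=set0.
  have Jfin : J udag \is a fin_num by rewrite ge0_fin_numE.
  set j := fine (J udag).
  have j_ge0 : 0 <= j by exact: fine_ge0.
  have j1_gt0 : 0 < j + 1 by rewrite ltr_wpDl.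
  (* The denominator [j + 1] instead of [j] covers the case [j = 0]. *)
  pose a := (tau - 1) * delta n / (j + 1).
  have gap_gt0 : 0 < (tau - 1) * delta n by rewrite mulr_gt0 ?subr_gt0.
  have a_gt0 : 0 < a by rewrite divr_gt0.
  exists a; split=> //.
  have Jj : (J udag <= j%:E)%E by rewrite fineK.
  have Ha : (H (v n a) (f n) <= (delta n + a * j)%:E)%E.
    by apply: solution_discrepancy_le (uv_solution n a a_gt0) feas _ _.
  apply: (le_trans Ha); rewrite lee_fin -lerBrDl -[X in _ - X]mul1r -mulrBl.
  by rewrite /a mulrAC ler_pdivrMr // ler_pM2l // lerDl.
have S_ub : has_ubound S.
  have gap : ((tau * delta n)%:E <
      limf_einf (fun a : R => H (v n a) (f n)) +oo%R)%E.
    by apply: (lt_le_trans _ (C_liminf n)); rewrite lte_fin ltr_pM2r.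
  have /limf_einf_gt_near[M [_ HM]] := gap.
  exists M => a [_ Ha]; rewrite leNgt; apply/negP => /HM.
  by rewrite ltNge Ha.
have s_gt0 : 0 < sup S.
  by apply: (lt_le_trans Sb.1); exact: ub_le_sup.
exists (sup S); split=> //.
exists (u n (sup S)), (v n (sup S)); split; first exact: uv_solution.
have -> : (fun a => if a == sup S then v n (sup S) else v n a) = v n.
  by apply/funext => a; case: eqP => [->|].
by rewrite -ereal_sup_EFin //; exists b.
Qed.
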